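(* Let $\Delta \ge 0$ be an integer, let $G$ be a finite graph of maximum degree $\Delta$, and let $A,B \subseteq V(G)$. Set $f(\Delta) = (\Delta+1)^{\Delta^2+1}$. Then for every positive integer $k$, either there exists a collection of $k$ vertex-disjoint and pairwise anticomplete $(A,B)$-paths in $G$, or there exists an $(A,B)$-separator in $G$ of size at most $k \cdot f(\Delta)$.
   Context: Graphs are finite and simple. A path is a non-empty sequence $v_1,\ldots,v_\ell$ of distinct vertices in which consecutive vertices are adjacent. It is an $(A,B)$-path if $v_1 \in A$ and $v_\ell \in B$. Two paths are anticomplete if there is no edge with one endpoint on one path and the other endpoint on the other path. A set $S \subseteq V(G)$ is an $(A,B)$-separator if every $(A,B)$-path contains a vertex of $S$. *)

(* Defs.v *)
From mathcomp Require Import all_boot.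

Set Implicit Arguments.
Unset Strict Implicit.
Unset Printing Implicit Defensive.

Record sgraph := SGraph {
  vertex :> finType;
  adj : rel vertex;
  adj_sym : symmetric adj;
  adj_irrefl : irreflexive adj
}.

Section Graphs.
Variable G : sgraph.
Implicit Types (A B S : {set G}) (s t : seq G).

Definition degree (v : G) : nat := #|[set w | adj v w]|.

(* Equal to 0 for the graph without vertices. *)
Definition max_degree : nat := \max_(v : G) degree v.

Definition is_path s : bool := [&& s != [::], uniq s & sorted (@adj G) s].

Definition is_AB_path A B s : bool :=
  if s is v :: p then [&& is_path s, v \in A & last v p \in B] else false.

Definition vertex_disjoint s t : Prop := forall x, x \in s -> x \notin t.

Definition anticomplete s t : Prop :=
  forall x y, x \in s -> y \in t -> ~~ adj x y.

Definition AB_separator A B S : Prop :=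
  forall s, is_AB_path A B s -> exists2 x, x \in s & x \in S.

End Graphs.

Definition f (Delta : nat) : nat := (Delta + 1) ^ (Delta ^ 2 + 1).

(* Main.v *)
(** Colour the vertices with Delta^2 + 1 colours so that the closed neighbourhoods
    of distinct vertices of the same colour are disjoint, and shrink the vertex set
    W one colour class I at a time, starting from Menger's theorem in G.
    Contracting N[v] in G[W] for every v of I in W divides the size of a separator
    by at most Delta + 1, so by Menger the contracted graph has enough disjoint
    A-B-paths; lift each of them to a shortest A-B-path of G[W] and let the new W
    be the union of the lifts. A vertex v of I that survives has all its remaining
    neighbours on its own induced path: at most two, at most one if v is in A or
    in B, and none if v is in both. These bounds persist when W shrinks further.
    Once all colours are treated they hold throughout W, and then a path through v
    has no room for an edge from v to another path. *)

Require Import Defs.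
From mathcomp Require Import all_boot.
From mathcomp Require Import zify.
From Stdlib Require Import Classical.

Set Implicit Arguments.
Unset Strict Implicit.
Unset Printing Implicit Defensive.

(** * Walks, separators and Menger's theorem for arbitrary relations *)

Section Walks.
Variable T : finType.
Implicit Types (e : rel T) (A B S : {set T}) (s p q : seq T) (x y z : T).

(** Vertices may repeat, so pieces of walks can be recombined freely; [walk_uniq] recovers simple
    ones. The relation is arbitrary because single arcs get deleted and contraction creates
    loops. *)
Definition walk e A B s : bool :=
  if s is x :: p then [&& path e x p, x \in A & last x p \in B] else false.

Definition separates e A B S : Prop :=
  forall s, walk e A B s -> exists2 z, z \in s & z \in S.

Definition disjoint_seqs (s t : seq T) : Prop := forall z : T, z \in s -> z \notin t.

Lemma walk_split e A B p z q :
  walk e A B (p ++ z :: q) =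
  walk e A [set z] (rcons p z) && walk e [set z] B (z :: q).
Proof.
case: p => [|a p] /=; first by rewrite !inE eqxx andbT andTb andbCA.
rewrite cat_path rcons_path last_rcons last_cat /= !inE eqxx /= andbT.
by rewrite -!andbA; do !bool_congr.
Qed.

Lemma walk_bypass e A B p x q y t :
  walk e A B (p ++ x :: q ++ y :: t) -> e x y ->
  walk e A B (p ++ x :: y :: t).
Proof.
rewrite walk_split (walk_split e A B p) => /andP[-> /=].
rewrite cat_path last_cat /= => /and3P[/and3P[_ _ ->] _ ->] ->.
by rewrite inE eqxx.
Qed.

Lemma walk_uniq e A B s :
  walk e A B s ->
  exists s', [/\ walk e A B s', uniq s' & {subset s' <= s}].
Proof.
case: s => //= x p /and3P[xp xA xB].
case: (shortenP xp) xB => p' xp' Up' sub_p' xB.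
exists (x :: p'); split => //=; first by rewrite xp' xA.
by move=> z; rewrite !inE => /predU1P[->|/sub_p'->]; rewrite ?eqxx ?orbT.
Qed.

Lemma last_hit (P : pred T) s :
  has P s -> exists s1 x s2, [/\ s = s1 ++ x :: s2, P x & ~~ has P s2].
Proof.
elim: s => //= x s IHs.
have [/IHs [s1 [y [s2 [-> Py s2P]]]] _|sP] := boolP (has P s).
  by exists (x :: s1), y, s2.
by rewrite orbF => Px; exists [::], x, s.
Qed.

Lemma first_hit (P : pred T) s :
  has P s -> exists s1 x s2, [/\ s = s1 ++ x :: s2, P x & ~~ has P s1].
Proof.
by move=> /split_find [x s1 s2 Px s1P]; exists s1, x, s2; rewrite cat_rcons.
Qed.

Section EdgeDeletion.
Variables (e : rel T) (x y : T).

Let e' : rel T := [rel a b | e a b && ((a, b) != (x, y))].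

(** Only [belast] has to avoid [x]: the deleted arc leaves [x], so a path may still end there. *)
Lemma path_del_source a p : path e a p -> x \notin belast a p -> path e' a p.
Proof.
elim: p a => //= b p IHp a /andP[eab /IHp bp]; rewrite inE negb_or.
move=> /andP[xa /bp ->]; rewrite andbT /e' /= eab /=.
by apply: contra xa => /eqP[-> _].
Qed.

Lemma path_del_target a p : path e a p -> y \notin p -> path e' a p.
Proof.
elim: p a => //= b p IHp a /andP[eab /IHp bp]; rewrite inE negb_or.
move=> /andP[yb /bp ->]; rewrite andbT /e' /= eab /=.
by apply: contra yb => /eqP[_ ->].
Qed.

Lemma walk_del_source A B s : walk e A B s -> x \notin s -> walk e' A B s.
Proof.
case: s => //= a p /and3P[ap -> ->]; rewrite !andbT => xp.
by apply: path_del_source => //; apply: contra xp => /mem_belast.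
Qed.

Lemma walk_del_target A B s : walk e A B s -> y \notin s -> walk e' A B s.
Proof.
case: s => //= a p /and3P[ap -> ->]; rewrite inE negb_or !andbT => /andP[_ yp].
exact: path_del_target.
Qed.

End EdgeDeletion.

Definition linked e A B n : Prop :=
  exists P : 'I_n -> seq T,
    (forall i, walk e A B (P i)) /\
    (forall i j, i != j -> disjoint_seqs (P i) (P j)).

Lemma linked_uniq e A B n :
  linked e A B n ->
  exists P : 'I_n -> seq T,
    (forall i, walk e A B (P i) /\ uniq (P i)) /\
    (forall i j z, z \in P i -> z \in P j -> i = j).
Proof.
move=> [P [walkP disjP]].
have [P' P'P] := fin_all_exists (fun i => walk_uniq (walkP i)).
exists P'; split=> [i|i j z]; first by case: (P'P i).
case: (P'P i) (P'P j) => _ _ subi [_ _ subj] /subi zi /subj zj.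
by apply/eqP; apply: contraTT zj => /disjP; apply.
Qed.

Lemma separates_large e A B n :
  (forall S, separates e A B S -> n <= #|S|) \/
  exists2 S, separates e A B S & #|S| < n.
Proof.
have [[S ? ?]|noS] := classic (exists2 S, separates e A B S & #|S| < n).
  by right; exists S.
by left=> S sepS; rewrite leqNgt; apply/negP => ltSn; apply: noS; exists S.
Qed.

Lemma inj_onto n (g : 'I_n -> T) S :
  injective g -> (forall i, g i \in S) -> #|S| <= n ->
  forall z, z \in S -> exists i, g i = z.
Proof.
move=> inj_g gS leSn z zS.
have sub : g @: setT \subset S by apply/subsetP => _ /imsetP[i _ ->].
have /eqP E : g @: setT == S.
  by rewrite eqEcard sub card_imset // cardsT card_ord.
by move: zS; rewrite -E => /imsetP[i _ ->]; exists i.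
Qed.

Lemma walk_glue e A B S S' x s t :
  walk e A S s -> walk e S' B t -> e (last x s) (head x t) ->
  walk e A B (s ++ t).
Proof.
case: s t => [|a s] [|b t] //= /and3P[as_ aA _] /and3P[bt _ bB] eab.
by rewrite cat_path last_cat /= as_ eab bt aA.
Qed.

Lemma walk_glue_at e A B S S' x s t :
  walk e A S s -> walk e S' B t -> last x s = head x t ->
  walk e A B (s ++ behead t).
Proof.
case: s t => [|a s] [|b t] //= /and3P[as_ aA _] /and3P[bt _ bB] eab.
by rewrite cat_path last_cat as_ eab bt aA.
Qed.

Lemma walk_last e A B x s : walk e A B s -> (last x s \in B) * (last x s \in s).
Proof. by case: s => //= a s /and3P[_ _ ->]; rewrite mem_last. Qed.

Lemma walk_head e A B x s : walk e A B s -> (head x s \in A) * (head x s \in s).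
Proof. by case: s => //= a s /and3P[_ -> _]; rewrite mem_head. Qed.

Lemma sub_walk e e' A B s : subrel e e' -> walk e A B s -> walk e' A B s.
Proof. by case: s => //= a s /sub_path sub /and3P[/sub-> -> ->]. Qed.

(* Göring's proof: if deleting the edge (x, y) creates a separator S that is too
   small, then x |: S and y |: S are separators of minimum size, and linkages from
   A to x |: S and from y |: S to B in the smaller graph are glued along S and
   along the edge (x, y). *)
Theorem menger e A B n :
  (forall S, separates e A B S -> n <= #|S|) -> linked e A B n.
Proof.
pose edges (r : rel T) := [set a : T * T | r a.1 a.2].
have [m] := ubnP #|edges e|.
elim: m => // m IHm in e A B n *; rewrite ltnS => le_em sep_n.
have [e0|[[x y] ]] := set_0Vmem (edges e).
  (* Without arcs a walk is a single vertex of [A :&: B], so this intersection is itself a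
     separator. *)
  have nAB : n <= #|A :&: B|.
    apply: sep_n => -[//|a [|b p]] /=.
      by move=> aAB; exists a; rewrite ?inE ?eqxx.
    by have := in_set0 (a, b); rewrite -e0 inE /= => ->.
  exists (fun i => [:: enum_val (widen_ord nAB i)]); split=> [i|i j neq_ij z].
    by have := enum_valP (widen_ord nAB i); rewrite inE /= => /andP[-> ->].
  rewrite !inE => /eqP->; apply: contra neq_ij.
  move=> /eqP /enum_val_inj /(congr1 val) /= E.
  by apply/eqP/val_inj.
rewrite inE /= => exy.
pose e' : rel T := [rel a b | e a b && ((a, b) != (x, y))].
have sub_e' : subrel e' e by move=> a b /andP[].
have lt_e' : #|edges e'| < m.
  apply: leq_trans le_em; apply: proper_card; apply/properP; split.
    by apply/subsetP=> -[a b]; rewrite !inE => /sub_e'.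
  by exists (x, y); rewrite !inE //= /e' /= eqxx andbF.
have [|[S sepS ltSn]] := separates_large e' A B n.
  move=> /(IHm _ _ _ _ lt_e') [P [walkP disjP]].
  by exists P; split=> // i; apply: sub_walk (walkP i).
have sepSx : separates e A B (x |: S).
  move=> s s_walk; have [xs|xs] := boolP (x \in s).
    by exists x; rewrite // !inE eqxx.
  have [z zs zS] := sepS s (walk_del_source y s_walk xs).
  by exists z; rewrite // !inE zS orbT.
have sepSy : separates e A B (y |: S).
  move=> s s_walk; have [ys|ys] := boolP (y \in s).
    by exists y; rewrite // !inE eqxx.
  have [z zs zS] := sepS s (walk_del_target x s_walk ys).
  by exists z; rewrite // !inE zS orbT.
(* Otherwise [x |: S] would be [S], a separator for [e] with fewer than [n] elements. *)
have xNS : x \notin S.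
  apply: contraL ltSn => xS; rewrite -leqNgt; apply: sep_n.
  by rewrite -(setUidPr (_ : [set x] \subset S)) ?sub1set.
have yNS : y \notin S.
  apply: contraL ltSn => yS; rewrite -leqNgt; apply: sep_n.
  by rewrite -(setUidPr (_ : [set y] \subset S)) ?sub1set.
(* A set separating [A] from [x |: S] in [e'] also separates [A] from [B] in [e]: cut a walk at its
   first vertex in [x |: S]; the initial piece does not use the deleted arc. *)
have [P [walkP disjP]] : exists P : 'I_n -> seq T,
    (forall i, walk e' A (x |: S) (P i) /\ uniq (P i)) /\
    (forall i j z, z \in P i -> z \in P j -> i = j).
  apply: linked_uniq; apply: IHm => // X sepX; apply: sep_n => s s_walk.
  have /hasP/first_hit [s1 [z [s2 [Es zS s1S]]]] := sepSx s s_walk.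
  have : walk e' A (x |: S) (rcons s1 z).
    move: s_walk; rewrite Es walk_split => /andP[s1_walk _].
    case: s1 {Es} s1S s1_walk => [_|a s1 s1S] /=; first by move=> /andP[->].
    rewrite last_rcons => /andP[s1_path /andP[-> _]]; rewrite zS !andbT.
    apply: path_del_source => //; rewrite belast_rcons.
    by apply: contra s1S => xs1; apply/hasP; exists x; rewrite //= !inE eqxx.
  move=> /sepX [t ts1 tX]; exists t => //.
  by rewrite Es -cat_rcons mem_cat ts1.
have [Q [walkQ disjQ]] : exists P : 'I_n -> seq T,
    (forall i, walk e' (y |: S) B (P i) /\ uniq (P i)) /\
    (forall i j z, z \in P i -> z \in P j -> i = j).
  apply: linked_uniq; apply: IHm => // X sepX; apply: sep_n => s s_walk.
  have /hasP/last_hit [s1 [z [s2 [Es zS s2S]]]] := sepSy s s_walk.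
  have : walk e' (y |: S) B (z :: s2).
    move: s_walk; rewrite Es walk_split /= => /andP[_ /and3P[s2_path _ ->]].
    have -> : z \in y |: S by [].
    rewrite !andbT; apply: path_del_target => //.
    by apply: contra s2S => ys2; apply/hasP; exists y; rewrite //= !inE eqxx.
  move=> /sepX [t ts2 tX]; exists t => //.
  by rewrite Es mem_cat ts2 orbT.
pose z i := last x (P i); pose h i := head x (Q i).
have zP i : (z i \in x |: S) * (z i \in P i) by apply: walk_last (walkP i).1.
have hP i : (h i \in y |: S) * (h i \in Q i) by apply: walk_head (walkQ i).1.
have z_inj : injective z.
  by move=> i j E; apply: disjP (zP i).2 _; rewrite E (zP j).
have h_inj : injective h.
  by move=> i j E; apply: disjQ (hP i).2 _; rewrite E (hP j).
have z_onto := inj_onto z_inj (fun i => (zP i).1) _.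
have h_onto := inj_onto h_inj (fun i => (hP i).1) _.
rewrite cardsU1 xNS in z_onto; rewrite cardsU1 yNS in h_onto.
(* The bijection from [x |: S] to [y |: S] that fixes [S]; [g] then matches [P i] with the walk
   [Q (g i)] starting at [phi (z i)]. *)
pose phi a := if a == x then y else a.
have phiS a : a \in S -> phi a = a.
  by rewrite /phi; case: eqP => // -> xS; rewrite xS in xNS.
have phi_in a : a \in x |: S -> phi a \in y |: S.
  by rewrite !inE /phi; case: eqP => [_ _|_ /= ->]; rewrite ?eqxx ?orbT.
have phi_inj : {in x |: S &, injective phi}.
  move=> a b; rewrite !inE /phi.
  case: (a =P x) (b =P x) => [->|_] [->|_] //= aS bS E.
    by rewrite E bS in yNS.
  by rewrite -E aS in yNS.
have [g gP] := fin_all_exists (fun i => h_onto ltSn _ (phi_in _ (zP i).1)).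
have g_inj : injective g.
  move=> i j /(congr1 h); rewrite !gP => /phi_inj E; apply: z_inj.
  by apply: E; apply: (zP _).1.
(* Switching at [u] from [P i] to [Q (g j)] gives an [A]-[B] walk in [e'], which meets [S] in some
   [w]. As [w] ends some [P i0] and starts [Q (g i0)], and both families are simple and disjoint,
   [w = u] and hence [i = j]. *)
have PQ i j u : u \in P i -> u \in Q (g j) -> i = j.
  move=> ui uj; have [[wPi uPi] [wQj uQj]] := (walkP i, walkQ (g j)).
  have EP := splitPr ui; have EQ := splitPr uj.
  case: {-1}_ / EP (erefl (P i)) => p1 p2 EP.
  case: {-1}_ / EQ (erefl (Q (g j))) => q1 q2 EQ.
  have : walk e' A B (p1 ++ u :: q2).
    move: wPi wQj; rewrite EP EQ !walk_split => /andP[-> _] /andP[_ ->].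
    by [].
  move=> /sepS [w]; rewrite -cat_rcons mem_cat => wR wS.
  have wxS : w \in x |: S by rewrite !inE wS orbT.
  have [i0 zi0] := z_onto ltSn w wxS.
  have hi0 : h (g i0) = w by rewrite gP zi0 phiS.
  have [w1|w2] : w \in rcons p1 u \/ w \in u :: q2.
  - by case/orP: wR => [->|w2]; [left | right; rewrite inE w2 orbT].
  - have Ei : i0 = i.
      by apply: disjP (zP i0).2 _; rewrite zi0 EP -cat_rcons mem_cat w1.
    have wE : w = last u p2 by rewrite -zi0 Ei /z EP last_cat.
    have Ew : w = u.
      move: w1; rewrite mem_rcons inE => /predU1P[//|w1].
      move: uPi; rewrite EP cat_uniq => /and3P[_ /hasP[]].
      by exists w => //; rewrite wE mem_last.
    apply: g_inj; apply: disjQ uj; rewrite -Ei -Ew -hi0; exact: (hP _).2.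
  have Ej : i0 = j.
    by apply: g_inj; apply: disjQ (hP _).2 _; rewrite hi0 EQ mem_cat w2 orbT.
  have Ew : w = u.
    case: q1 EQ => [|b q1] EQ; first by rewrite -hi0 Ej /h EQ.
    have Eb : w = b by rewrite -hi0 Ej /h EQ.
    by move: uQj; rewrite EQ /= mem_cat -Eb w2 orbT.
  by apply: disjP ui _; rewrite -Ew -zi0 Ej (zP j).
(* If [P i] ends at [x], the arc leads on to [Q (g i)]; otherwise the two walks share a vertex,
   which is kept once. *)
exists (fun i => P i ++ if z i == x then Q (g i) else behead (Q (g i))).
split=> [i|i j neq_ij u].
  have [wP wQ] := (sub_walk sub_e' (walkP i).1, sub_walk sub_e' (walkQ (g i)).1).
  have := gP i; rewrite /phi; case: eqP => [zx hy|_ hz].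
    by apply: (walk_glue (x := x)) wP wQ _; rewrite -/(z i) -/(h _) zx hy.
  by apply: (walk_glue_at (x := x)) wP wQ _; rewrite -/(z i) -/(h _) hz.
have sub k v : v \in P k ++ (if z k == x then Q (g k) else behead (Q (g k))) ->
    v \in P k \/ v \in Q (g k).
  rewrite mem_cat => /orP[->|]; first by left.
  by case: ifP => _ => [->|/mem_behead ->]; right.
move=> /sub ui; apply/negP => /sub uj; case/eqP: neq_ij.
case: ui uj => [ui|ui] [uj|uj].
- exact: disjP ui uj.
- exact: PQ ui uj.
- by apply/esym; apply: PQ uj ui.
- by apply: g_inj; apply: disjQ ui uj.
Qed.

End Walks.

(** * Greedy colouring, a union bound and shortest walks *)

(** Vertices are coloured one at a time, and at most [D] of the [D.+1] colours are blocked. Leaving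
    out [u] itself from the count lets [r] be reflexive, as it is in the application. *)
Lemma greedy_coloring (T : finType) (r : rel T) D :
  symmetric r -> (forall u, #|[set v | (v != u) && r u v]| <= D) ->
  exists c : T -> 'I_D.+1, forall u v, u != v -> r u v -> c u != c v.
Proof.
move=> r_sym degD.
suff [c cP] : exists c : T -> 'I_D.+1,
    {in enum T &, forall u v, u != v -> r u v -> c u != c v}.
  by exists c => u v; apply: cP; rewrite mem_enum.
elim: (enum T) => [|u s [c cP]]; first by exists (fun=> ord0).
have [k kP] : exists k, k \notin c @: [set v | (v != u) && r u v].
  apply/existsP; rewrite -negb_forall; apply/negP => /forallP all_k.
  have := leq_trans (leq_imset_card c _) (degD u); rewrite leqNgt => /negP; apply.
  apply: (@leq_trans #|[set: 'I_D.+1]|); first by rewrite cardsT card_ord.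
  apply: subset_leq_card.
  by apply/subsetP => k _; apply: all_k.
have k_free v : v != u -> r u v -> k != c v.
  move=> vu ruv; apply: contra kP => /eqP ->; apply: imset_f.
  by rewrite inE vu.
exists (fun v => if v == u then k else c v) => v w; rewrite !inE.
case: (eqVneq v u) (eqVneq w u) => [->|vu] [->|wu] //=.
- by move=> _ _ _; apply: k_free.
- by move=> _ _ _; rewrite r_sym eq_sym; apply: k_free.
exact: cP.
Qed.

Lemma card_bigcup_leq (T I : finType) (P : pred I) (F : I -> {set T}) :
  #|\bigcup_(i | P i) F i| <= \sum_(i | P i) #|F i|.
Proof.
elim/big_rec2: _ => [|i n U _ leUn]; first by rewrite cards0.
by apply: leq_trans (leq_card_setU _ _) _; rewrite leq_add2l.
Qed.

(** Tuples make the existence of a walk of given length decidable, so a least length can be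
    taken. *)
Lemma shortest_walk (T : finType) (e : rel T) (A B U : {set T}) s0 :
  walk e A B s0 -> {subset s0 <= U} ->
  exists s, [/\ walk e A B s, {subset s <= U} &
    forall t, walk e A B t -> {subset t <= U} -> size s <= size t].
Proof.
move=> walk0 sub0.
pose P n := [exists t : n.-tuple T, walk e A B t && all [in U] t].
have PI t : walk e A B t -> {subset t <= U} -> P (size t).
  move=> wt /allP tU; apply/existsP; exists (in_tuple t); rewrite wt; exact: tU.
have exP : exists n, P n by exists (size s0); apply: PI.
case: (ex_minnP exP) => n /existsP[s /andP[ws /allP sU]] min_n.
exists s; split=> // t wt tU; rewrite size_tuple; exact: min_n (PI t wt tU).
Qed.

(** * Distance-two colouring and tight vertices *)

Section BoundedDegree.
Variables (G : sgraph) (A B : {set G}) (D : nat).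
Hypothesis degD : forall v : G, degree v <= D.
Implicit Types (U W : {set G}) (u v w x y : G).

Local Notation N v := [set w | adj v w].
Definition closed_nbhd v : {set G} := v |: N v.

Lemma card_closed_nbhd v : #|closed_nbhd v| <= D.+1.
Proof.
apply: leq_trans (leq_card_setU _ _) _; rewrite cards1 add1n ltnS; exact: degD.
Qed.

Lemma distance2_coloring :
  exists c : G -> 'I_(D ^ 2).+1, forall u v, c u = c v ->
    forall x, x \in closed_nbhd u -> x \in closed_nbhd v -> u = v.
Proof.
pose r : rel G := [rel u v | closed_nbhd u :&: closed_nbhd v != set0].
have r_sym : symmetric r by move=> u v; rewrite /r /= setIC.
have r_deg u : #|[set v | (v != u) && r u v]| <= D ^ 2.
  (* Such a [v] is a neighbour of [u] or has a common neighbour [z] with it. Since [u] is removed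
     from [N z], each [z] contributes at most [D] vertices, itself included. *)
  have sub : [set v | (v != u) && r u v] \subset
      \bigcup_(z in N u) (z |: N z :\ u).
    apply/subsetP => v; rewrite inE => /andP[vu /set0Pn[z]].
    rewrite !inE => /andP[/predU1P[->|uz] zv]; apply/bigcupP.
      move: zv; rewrite eq_sym (negPf vu) /= => vu'.
      by exists v; rewrite ?inE ?eqxx ?vu // adj_sym.
    exists z; rewrite !inE // vu /=.
    by case/predU1P: zv => [->|]; rewrite ?eqxx // adj_sym orbC => ->.
  apply: leq_trans (subset_leq_card sub) _.
  apply: leq_trans (card_bigcup_leq _ _) _.
  apply: (@leq_trans (\sum_(z in N u) D)).
    apply: leq_sum => z; rewrite inE => uz.
    apply: leq_trans (leq_card_setU _ _) _; rewrite cards1 add1n.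
    apply: leq_trans (degD z); rewrite /degree [X in _ <= X](cardsD1 u).
    by rewrite inE adj_sym uz.
  by rewrite sum_nat_const -mulnn leq_mul2r degD orbT.
have [c cP] := greedy_coloring r_sym r_deg; exists c => u v cuv x xu xv.
apply/eqP; apply: contra_eqT cuv => uv; apply: cP => //.
by apply/set0Pn; exists x; rewrite inE xu.
Qed.

(* An A-B-path through v already uses (v \notin A) + (v \notin B) neighbours
   of v, so it then contains all neighbours of v in W. *)
Definition tight W v : bool :=
  #|[set w in W | adj v w]| <= (v \notin A) + (v \notin B).

Lemma tight_sub W W' v : W' \subset W -> tight W v -> tight W' v.
Proof.
move=> /subsetP sub; apply: leq_trans; apply: subset_leq_card.
by apply/subsetP => w; rewrite !inE => /andP[/sub->].
Qed.

(** A chord at [v] would be a shortcut, so only the predecessor and the successor of [v] count; the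
    walk could start at [v] if [v] were in [A], and stop there if it were in [B]. *)
Lemma tight_shortest U s v :
  walk (@adj G) A B s -> {subset s <= U} ->
  (forall t, walk (@adj G) A B t -> {subset t <= U} -> size s <= size t) ->
  v \in s -> tight [set w in s] v.
Proof.
move=> ws sU min_s vs; case/splitPr: vs ws sU min_s => s1 s2 ws sU min_s.
have vA : s1 != [::] -> v \notin A.
  apply: contra => vA; rewrite -size_eq0.
  suff : size (s1 ++ v :: s2) <= size (v :: s2) by rewrite size_cat /=; lia.
  apply: min_s => [|w w2]; last by apply: sU; rewrite mem_cat w2 orbT.
  by move: ws; rewrite walk_split /= vA => /andP[_ /and3P[-> _ ->]].
have vB : s2 != [::] -> v \notin B.
  apply: contra => vB; rewrite -size_eq0.
  suff : size (s1 ++ v :: s2) <= size (rcons s1 v).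
    by rewrite size_cat size_rcons /=; lia.
  apply: min_s => [|w w1].
    move: ws; rewrite walk_split => /andP[+ _]; case: (s1) => /= [|b t].
      by rewrite vB => /andP[->].
    by rewrite !last_rcons vB => /and3P[-> -> _].
  by apply: sU; rewrite -cat_rcons mem_cat w1.
(* [drop (size s1).-1 s1] is the predecessor of [v] and [take 1 s2] its successor, each as a list
   that is empty if there is none. *)
have sub : {subset [set w in [set w in s1 ++ v :: s2] | adj v w]
              <= drop (size s1).-1 s1 ++ take 1 s2}.
  move=> w; rewrite !inE !mem_cat inE => /andP[ws12 vw].
  case/or3P: ws12 => [w1|/eqP Ewv|w2]; last 2 first.
  - by rewrite Ewv adj_irrefl in vw.
  - case/splitPr: w2 ws sU min_s {vB} => p q ws sU min_s.
    suff : size (s1 ++ v :: p ++ w :: q) <= size (s1 ++ v :: w :: q).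
      rewrite !size_cat /= ?size_cat /= => le_sz.
      have /size0nil -> : @size G p = 0 by lia.
      by rewrite /= take0 inE eqxx orbT.
    apply: min_s (walk_bypass ws vw) _ => x xs; apply: sU; move: xs.
    by rewrite !(mem_cat, inE) => /or4P[] ->; rewrite ?orbT.
  case/splitPr: w1 ws sU min_s {vA} => p q ws sU min_s.
  have wv : adj w v by rewrite adj_sym.
  rewrite -catA cat_cons in ws.
  suff : size ((p ++ w :: q) ++ v :: s2) <= size (p ++ w :: v :: s2).
    rewrite !size_cat /= ?size_cat /= => le_sz.
    have /size0nil -> : @size G q = 0 by lia.
    by rewrite /= addn1 /= drop_size_cat // inE eqxx.
  apply: min_s (walk_bypass ws wv) _ => x xs; apply: sU; move: xs.
  by rewrite !(mem_cat, inE) => /or4P[] ->; rewrite ?orbT.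
apply: leq_trans (subset_leq_card (introT subsetP sub)) _.
apply: leq_trans (card_size _) _; rewrite size_cat; apply: leq_add.
  by case: (s1) vA => //= b t -> //; rewrite size_drop /= subSnn.
by case: (s2) vB => //= b t -> //; rewrite take0.
Qed.

(** Walks of [G] confined to [W] stand for walks of the induced subgraph, so the vertex type never
    changes. *)
Definition linked_in W n : Prop :=
  exists P : 'I_n -> seq G,
    [/\ forall i, walk (@adj G) A B (P i), forall i, {subset P i <= W} &
        forall i j, i != j -> disjoint_seqs (P i) (P j)].

(** The easy direction of Menger's theorem: disjoint walks are hit in distinct vertices. *)
Lemma linked_in_hitting W n (S : {set G}) :
  linked_in W n ->
  (forall s, walk (@adj G) A B s -> {subset s <= W} ->
     exists2 z, z \in s & z \in S) ->
  n <= #|S|.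
Proof.
move=> [P [walkP subP disjP]] hitS.
have [g gP] : exists g : 'I_n -> G, forall i, g i \in P i /\ g i \in S.
  apply: (fin_all_exists (P := fun i z => z \in P i /\ z \in S)) => i.
  by have [z] := hitS _ (walkP i) (subP i); exists z.
have g_inj : injective g.
  move=> i j Eg; apply/eqP; apply: contraT => /disjP /(_ _ (gP i).1) /negP.
  by case; rewrite Eg (gP j).1.
rewrite -[n]card_ord -cardsT -(card_imset _ g_inj); apply: subset_leq_card.
by apply/subsetP => _ /imsetP[i _ ->]; apply: (gP i).2.
Qed.

(** * Contraction of the closed neighbourhoods around one colour class *)

Section Contraction.
Variables (I W : {set G}).
Hypothesis disjI : {in I &, forall u v x,
  x \in closed_nbhd u -> x \in closed_nbhd v -> u = v}.

(* Contracts closed_nbhd v :&: W to v, for each v in I :&: W. *)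
Definition contract x : G :=
  if [pick v in I :&: W | x \in closed_nbhd v] is Some v then v else x.

Lemma contract_center v x :
  v \in I -> v \in W -> x \in closed_nbhd v -> contract x = v.
Proof.
move=> vI vW xv; rewrite /contract; case: pickP => [u|/(_ v)].
  by rewrite in_setI -andbA => /and3P[uI _ xu]; apply: (disjI uI vI xu xv).
by rewrite /= xv inE vI vW.
Qed.

Lemma mem_contract x : x \in closed_nbhd (contract x).
Proof.
by rewrite /contract; case: pickP => [u /andP[]//|_]; rewrite !inE eqxx.
Qed.

Lemma contract_in x : x \in W -> contract x \in W.
Proof.
by rewrite /contract; case: pickP => // u /andP[]; rewrite inE => /andP[].
Qed.

Lemma contract_idem x : contract (contract x) = contract x.
Proof.
have [E|[cI cW]] : contract x = x \/ contract x \in I /\ contract x \in W.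
  rewrite /contract; case: pickP => [u /andP[]|_]; last by left.
  by rewrite inE => /andP[]; right.
  by rewrite !E.
by apply: contract_center => //; rewrite !inE eqxx.
Qed.

(** The quotient graph, kept on the vertices of [G] through representatives; an edge inside a fibre
    becomes a loop. *)
Definition contract_adj : rel G :=
  [rel s t | [exists x in W, exists y in W,
     [&& adj x y, contract x == s & contract y == t]]].

Lemma contract_walk s :
  walk (@adj G) A B s -> {subset s <= W} ->
  walk contract_adj (contract @: (A :&: W)) (contract @: (B :&: W))
    (map contract s).
Proof.
case: s => //= x p /and3P[xp xA xB] sW.
have [xW lW] := (sW x (mem_head _ _), sW _ (mem_last x p)).
rewrite last_map !imset_f ?inE ?xA ?xB ?xW ?lW // !andbT.
elim: p x xp sW {xA xB xW lW} => //= y p IHp x /andP[xy yp] sW.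
rewrite IHp // ?andbT; last by move=> z zp; apply: sW; rewrite inE zp orbT.
apply/existsP; exists x; rewrite sW ?mem_head //=.
apply/existsP; exists y; rewrite sW ?xy ?eqxx // inE mem_head orbT //.
Qed.

(** Within [W], each fibre of [contract] is spanned by a star around its representative, and
    contracted arcs come from edges of [G]. The preimage of [p] therefore joins [A] to [B]. *)
Lemma walk_lift p :
  walk contract_adj (contract @: (A :&: W)) (contract @: (B :&: W)) p ->
  exists2 s, walk (@adj G) A B s & {subset s <= [set x in W | contract x \in p]}.
Proof.
case: p => // t p; set U := [set x in W | _].
pose r : rel G := [rel x y | [&& x \in U, y \in U & adj x y]].
have r_sym : symmetric r by move=> x y; rewrite /r /= adj_sym andbCA.
have hub x : x \in U -> connect r (contract x) x.
  move=> xU; have := mem_contract x; rewrite !inE => /predU1P[<-//|cx].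
  apply: connect1; rewrite /r /= xU cx andbT inE.
  by move: xU; rewrite inE contract_idem => /andP[/contract_in-> ->].
have hub' x : x \in U -> connect r x (contract x).
  by move=> xU; rewrite (sym_connect_sym r_sym) hub.
move=> /= /and3P[tp /imsetP[a]]; rewrite inE => /andP[aA aW] ta.
move=> /imsetP[b]; rewrite inE => /andP[bB bW] lb.
have aU : a \in U by rewrite inE aW -ta mem_head.
have bU : b \in U by rewrite inE bW -lb mem_last.
have sub q u : {subset u :: q <= t :: p} -> path contract_adj u q ->
    connect r u (last u q).
  elim: q u => [|v q IHq] u //= sub /andP[uv vq].
  have subq : {subset v :: q <= t :: p}.
    by move=> z zq; apply: sub; rewrite inE zq orbT.
  apply: connect_trans (IHq _ subq vq).
  case/existsP: uv => x /andP[xW /existsP[y /andP[yW /and3P[xy /eqP Ex /eqP Ey]]]].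
  have xU : x \in U by rewrite inE xW Ex sub ?mem_head.
  have yU : y \in U by rewrite inE yW Ey subq ?mem_head.
  rewrite -Ex -Ey; apply: connect_trans (hub _ xU) _.
  by apply: connect_trans (hub' _ yU); apply: connect1; rewrite /r /= xU yU.
have /connectP[q aq bq] : connect r a b.
  apply: connect_trans (hub' a aU) _; rewrite -ta.
  by apply: connect_trans (sub p t _ tp) _ => //; rewrite lb hub.
exists (a :: q); rewrite /= ?aA -?bq ?bB ?andbT.
  by apply: sub_path aq => x y /and3P[].
move=> z; rewrite inE => /predU1P[->//|].
elim: q a aq {aA aW ta aU bq} => //= c q IHq a /andP[/and3P[_ cU _] cq].
by rewrite inE => /predU1P[->//|]; apply: IHq cq.
Qed.

Lemma contract_linked n :
  linked_in W (n * D.+1) ->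
  exists W', [/\ W' \subset W, linked_in W' n &
    {in W', forall v, v \in I -> tight W' v}].
Proof.
move=> linkedW.
have : linked contract_adj (contract @: (A :&: W)) (contract @: (B :&: W)) n.
  (* The closed neighbourhoods of the vertices of a separator [S] together hit all walks in [W], so
     [n * D.+1 <= #|S| * D.+1]. *)
  apply: menger => S sepS; rewrite -(leq_pmul2r (ltn0Sn D)).
  apply: leq_trans (_ : #|\bigcup_(v in S) closed_nbhd v| <= _).
    apply: linked_in_hitting linkedW _ => s ws sW.
    have [_ /mapP[x xs ->] cxS] := sepS _ (contract_walk ws sW).
    by exists x => //; apply/bigcupP; exists (contract x); last exact: mem_contract.
  apply: leq_trans (card_bigcup_leq _ _) _; rewrite -sum_nat_const.
  by apply: leq_sum => v _; apply: card_closed_nbhd.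
move=> [P [walkP disjP]].
(* Each lift is shortest within the preimage of [P i]; these preimages are disjoint for distinct
   [i]. *)
have [Q QP] := fin_all_exists (fun i =>
  let: ex_intro2 s ws sU := walk_lift (walkP i) in shortest_walk ws sU).
have disjQ i j x y : x \in Q i -> y \in Q j -> contract x = contract y -> i = j.
  case: (QP i) (QP j) => _ subi _ [_ subj _] /subi + /subj.
  rewrite !inE => /andP[_ xi] /andP[_ yj] E; rewrite -E in yj.
  by apply/eqP; apply: contraTT yj => /disjP; apply.
pose W' := \bigcup_i [set x in Q i].
have QW' i : {subset Q i <= W'}.
  by move=> x xi; apply/bigcupP; exists i; rewrite ?inE.
have W'W : W' \subset W.
  apply/bigcupsP => i _; apply/subsetP => x; rewrite inE.
  by case: (QP i) => _ sub _ /sub; rewrite inE => /andP[].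
exists W'; split=> //.
  exists Q; split=> [i||i j neq_ij x xi] //; first by case: (QP i).
  by apply: contra neq_ij => xj; apply/eqP; apply: disjQ xi xj _.
move=> v vW' vI; have vW := subsetP W'W v vW'.
have [i _] := bigcupP vW'; rewrite inE => vi.
case: (QP i) => ws sU min_s.
(* A neighbour [w] of [v] in [W'] also contracts to [v], so it lies on the same lift as [v], and the
   bound for that lift suffices. *)
apply: leq_trans (tight_shortest ws sU min_s vi).
apply: subset_leq_card; apply/subsetP => w; rewrite !inE.
case/andP => /bigcupP[j _]; rewrite inE => wj vw; rewrite vw andbT.
suff -> : i = j by [].
have vC : v \in closed_nbhd v by rewrite !inE eqxx.
have wC : w \in closed_nbhd v by rewrite !inE vw orbT.
by apply: disjQ vi wj _; rewrite !(contract_center vI vW).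
Qed.

End Contraction.

(** * Iteration over the colours, and anticompleteness *)

Lemma iterated_contraction (K : eqType) (c : G -> K) (L : seq K) W n :
  (forall u v, c u = c v ->
    forall x, x \in closed_nbhd u -> x \in closed_nbhd v -> u = v) ->
  linked_in W (n * D.+1 ^ size L) ->
  exists W', [/\ W' \subset W, linked_in W' n &
    {in W', forall v, c v \in L -> tight W' v}].
Proof.
move=> c_disj; elim: L => [|k L IHL] /= in W *; first by rewrite muln1; exists W.
(* One factor [D.+1] pays for colour [k]; the others are spent on shrinking [W1], which keeps the
   vertices of colour [k] tight. *)
rewrite expnSr mulnA => /(@contract_linked [set v | c v == k]) [].
  move=> u v; rewrite !inE => /eqP cu /eqP cv x.
  by apply: c_disj; rewrite cu cv.
move=> W1 [sub1 /IHL[W' [sub' linked' tight']] tight1].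
exists W'; split=> // [|v vW']; first exact: subset_trans sub1.
rewrite inE => /predU1P[cvk|]; last exact: tight'.
apply: tight_sub (sub') _; apply: tight1; last by rewrite inE cvk.
exact: (subsetP sub').
Qed.

(** The predecessor and successor of [v] on [s] already exhaust the bound in [tight]; a neighbour
    off [s] would exceed it. *)
Lemma tight_path_closed W s v w :
  walk (@adj G) A B s -> uniq s -> {subset s <= W} -> v \in s ->
  tight W v -> w \in W -> adj v w -> w \in s.
Proof.
move=> ws us sW vs tight_v wW vw; apply: contraT => wNs; move: tight_v.
rewrite /tight leqNgt => /negP[].
have le_in (t : seq G) : uniq t -> {subset t <= s} -> {in t, forall x, adj v x} ->
    size t < #|[set w in W | adj v w]|.
  move=> ut ts tv; have uwt : uniq (w :: t).
    by rewrite /= ut andbT; apply: contra wNs => /ts.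
  rewrite -[(size t).+1]/(size (w :: t)) -(card_uniqP uwt).
  apply: subset_leq_card; apply/subsetP => x; rewrite !inE => /predU1P[->|xt].
    by rewrite wW.
  by rewrite (tv x xt) sW ?ts.
case/splitPr: vs ws us {wNs sW} le_in => s1 s2 ws us le_in.
pose t1 := drop (size s1).-1 s1; pose t2 := take 1 s2.
have sub_t : subseq (t1 ++ t2) (s1 ++ v :: s2).
  apply: cat_subseq; first exact: drop_subseq.
  exact: subseq_trans (take_subseq _ _) (subseq_cons _ _).
move: ws; rewrite walk_split => /andP[ws1 ws2].
apply: leq_ltn_trans (le_in (t1 ++ t2) _ _ _).
(* Without a predecessor [v] starts the walk, so [v \in A] and its term vanishes; likewise for the
   successor and [B]. *)
- rewrite size_cat; apply: leq_add.
    move: ws1; rewrite /t1; case: (s1) => [/= /andP[->]//|y t _].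
    by rewrite size_drop /= subSnn; case: (v \notin A).
  move: ws2; rewrite /t2; case: (s2) => [/= /andP[_ ->]//|y t _].
  by rewrite /= take0; case: (v \notin B).
- exact: subseq_uniq sub_t us.
- exact: mem_subseq.
move=> x; rewrite mem_cat => /orP[].
  move: ws1; rewrite /t1; case/lastP: (s1) => // t y.
  rewrite size_rcons /= -!cats1 -catA walk_split drop_size_cat // inE.
  by move=> /andP[_ /andP[/andP[yv _] _]] /eqP->; rewrite adj_sym.
move: ws2; rewrite /t2; case: (s2) => //= y t /andP[/andP[vy _] _].
by rewrite take0 inE => /eqP->.
Qed.

End BoundedDegree.

Theorem theorem1p1 (Delta : nat) (G : sgraph) (A B : {set G})
    (hDelta : max_degree G = Delta) (k : nat) (hk : 0 < k) :
  (exists P : 'I_k -> seq G,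
      (forall i, is_AB_path A B (P i)) /\
      (forall i j, i != j ->
         vertex_disjoint (P i) (P j) /\ anticomplete (P i) (P j)))
  \/
  (exists S : {set G}, AB_separator A B S /\ #|S| <= k * f Delta).
Proof.
have degD (v : G) : degree v <= Delta.
  by rewrite -hDelta; exact: leq_bigmax.
have [large|[S sepS ltS]] := separates_large (@adj G) A B (k * f Delta); last first.
  right; exists S; split; last exact: ltnW.
  move=> [|x p] // /and3P[/and3P[_ _ xp] xA xB].
  by apply: sepS; rewrite /= xA xB !andbT.
have [c c_disj] := distance2_coloring degD.
have [P [walkP disjP]] := menger large.
(* All [Delta ^ 2 + 1] colours are listed, so the total loss is exactly the factor [f Delta]. *)
have [|W' [_ [Q [walkQ subQ disjQ]] tightW']] :=
    @iterated_contraction G A B Delta degD _ c (enum 'I_(Delta ^ 2).+1) setT k c_disj.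
  rewrite size_enum_ord -[Delta.+1]addn1 -[(_ ^ 2).+1]addn1.
  by exists P; split=> // i x; rewrite inE.
have tightW v : v \in W' -> tight A B W' v.
  by move=> /tightW'; apply; rewrite mem_enum.
left.
(* [linked_in] does not record simplicity, so the walks are shortened; tightness refers to [W'],
   which stays unchanged. *)
have [R RP] := fin_all_exists (fun i => walk_uniq (walkQ i)).
have walkR i : walk (@adj G) A B (R i) by case: (RP i).
have uniqR i : uniq (R i) by case: (RP i).
have subR i : {subset R i <= W'} by case: (RP i) => _ _ sub x /sub /subQ.
have disjR i j : i != j -> disjoint_seqs (R i) (R j).
  case: (RP i) (RP j) => _ _ subi [_ _ subj] /disjQ disj x /subi /disj.
  by apply: contra; apply: subj.
exists R; split=> [i|i j neq_ij].
  move: (walkR i) (uniqR i); case: (R i) => //= x p /and3P[xp -> ->] U.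
  by rewrite /is_path /= xp U.
split=> [|x y xi yj]; first exact: disjR.
(* As [x] is tight in [W'], its neighbour [y] would lie on [R i] too, against disjointness from
   [R j]. *)
apply/negP => xy; suff /(disjR _ _ neq_ij)/negP : y \in R i by [].
apply: tight_path_closed (xi) _ _ xy; [exact: walkR|exact: uniqR|exact: subR| |].
- exact/tightW/subR/xi.
- exact: subR yj.
Qed.
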